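(* Let $X$ be a $1$-complemented subspace of a Banach space $Y$ with a shrinking $1$-unconditional basis. Then the Calkin algebra $\mathcal{B}(X)/\mathcal{K}(X)$ fails the ball covering property (BCP).
   Context: A normed space $Z$ has the ball covering property (BCP) if its unit sphere $\{z\in Z:\|z\|=1\}$ can be covered by countably many open balls $B(z_i,r_i)$ with $r_i\le\|z_i\|$ for each $i$ (i.e. open balls none of which contains the origin). $\mathcal{B}(X)$ is the space of bounded linear operators on $X$ with the operator norm and $\mathcal{K}(X)$ is the closed subspace of compact operators. The Calkin algebra $\mathcal{B}(X)/\mathcal{K}(X)$ carries the quotient norm, which is the essential norm $\|T\|_e=\inf\{\|T-K\|:K\in\mathcal{K}(X)\}$. A Schauder basis $(e_n)_{n\in\mathbb{N}}$ is unconditional if there is a constant $C\ge 1$ such that $\|\sum a_ne_n\|\le C\|\sum b_ne_n\|$ for all scalar sequences $(a_n),(b_n)$ with $|a_n|\le|b_n|$ for all $n$ (for which the series converge); the best such $C$ is its unconditional constant. The basis is $1$-unconditional if this constant is $1$. The basis is shrinking if the closed linear span of its biorthogonal functionals $(e_n^* )$ is the whole dual space. $X\subset Y$ is $1$-complemented if there is a linear projection of norm one from $Y$ onto $X$.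
   Formalization: The formal theorem assumes in addition that X is infinite-dimensional; for finite-dimensional X the Calkin algebra is zero, its unit sphere is empty, and the BCP holds trivially, so the claim as stated fails there. *)

(* Defs.v *)
From HB Require Import structures.
From mathcomp Require Import all_boot all_order all_algebra generic_quotient.
From mathcomp Require Import ring_quotient.
From mathcomp Require Import complex finmap.
From mathcomp Require Import all_classical all_reals all_analysis.
Set Implicit Arguments.
Unset Strict Implicit.
Unset Printing Implicit Defensive.
Import Order.TTheory GRing.Theory Num.Theory.
Import numFieldNormedType.Exports.
Local Open Scope classical_set_scope.
Local Open Scope ring_scope.
Local Open Scope quotient_scope.

(* The scalar field is either the reals or the complex numbers. Norms over [K]
   take values in [K]; when [K] is the complex field the order is the partial
   one ([x <= y] iff [y - x] is a nonnegative real), so that suprema and infima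
   of sets of norms are taken with the generic [supremum] and [infimum]. *)
Variant scalar_kind := RealScalars | ComplexScalars.

Definition scalarField (R : realType) (k : scalar_kind) : numFieldType :=
  match k with
  | RealScalars => R
  | ComplexScalars => R[i]
  end.

Section scalar_bounds.
Variables (R : realType) (k : scalar_kind).
Local Notation K := (scalarField R k).
Implicit Type A : set K.

Lemma scalar_sup A : A !=set0 -> (forall a, A a -> 0 <= a) ->
  ubound A !=set0 -> supremums A !=set0.
Proof.
case: k A => A [a Aa] A0 [M AM].
- exists (sup A : R); have hs : has_sup (A : set R) by split; [exists a|exists M].
  split => [x Ax|x Ax]; first exact: (sup_upper_bound hs).
  by apply: ge_sup => //; exists a.
- pose B : set R := [set r | A (r%:C)%C].
  have AB x : A x -> exists2 r, x = (r%:C)%C & B r.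
    move=> Ax; have := A0 _ Ax; case: x Ax => r i Ax.
    rewrite lecE /= => /andP[/eqP i0 _]; rewrite i0 in Ax *.
    by exists r.
  have hB : has_sup B.
    split; first by have [r _ Br] := AB _ Aa; exists r.
    exists (complex.Re M) => r /= /AM.
    by case: (M : R[i]) => m j /=; rewrite lecE /= => /andP[].
  exists ((sup B)%:C)%C; split=> [x /AB[r -> Br]|x xA].
    by rewrite lecR; exact: (sup_upper_bound hB).
  have [r ra Br] := AB _ Aa.
  have := xA _ Aa; rewrite ra; case: x xA => m j xA.
  rewrite !lecE /= => /andP[/eqP j0 _]; rewrite j0 eqxx /=.
  apply: ge_sup; first by exists r.
  by move=> s /= /xA; rewrite lecE /= => /andP[].
Qed.

Lemma scalar_inf A : A !=set0 -> (forall a, A a -> 0 <= a) ->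
  infimums A !=set0.
Proof.
move=> [a Aa] A0.
pose B : set K := [set l | 0 <= l /\ lbound A l].
have [||s [sB Bs]] := @scalar_sup B _ (fun x => @proj1 _ _).
- by exists 0; split => // x /A0.
- by exists a => x [_]; exact.
exists s; split=> [x Ax|l lA]; first by apply: Bs => y [_]; exact.
have lr : l \is Num.real by rewrite (ler_real (lA _ Aa)) ger0_real// A0.
have s0 : 0 <= s by apply: sB; split=> // x /A0.
have [l0|/ltW l0] := real_leP (real0 K) lr; first exact: sB.
exact: le_trans l0 s0.
Qed.

Lemma supremum_ub A : supremums A !=set0 -> ubound A (supremum 0 A).
Proof.
move=> [s sA] x Ax; rewrite /supremum ifF; last by apply/negbTE/set0P; exists x.
by case: xgetP => [y _ [+ _]|/(_ s)//]; apply.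
Qed.

Lemma supremum_le A M : A !=set0 -> supremums A !=set0 -> ubound A M ->
  supremum 0 A <= M.
Proof.
rewrite /supremum => /set0P/negbTE -> -[s sA] AM.
by case: xgetP => [y _ [_]|/(_ s)//]; apply.
Qed.

Lemma infimum_lb A : infimums A !=set0 -> lbound A (infimum 0 A).
Proof.
move=> [s sA] x Ax; rewrite /infimum ifF; last by apply/negbTE/set0P; exists x.
by case: xgetP => [y _ [+ _]|/(_ s)//]; apply.
Qed.

Lemma infimum_ge A m : A !=set0 -> infimums A !=set0 -> lbound A m ->
  m <= infimum 0 A.
Proof.
rewrite /infimum => /set0P/negbTE -> -[s sA] Am.
by case: xgetP => [y _ [_]|/(_ s)//]; apply.
Qed.

End scalar_bounds.

Section closed_subspaces.
Variable K : numFieldType.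

Record closedSubspace (V : normedModType K) := ClosedSubspace {
  carrier :> set V ;
  carrier0 : carrier 0 ;
  carrier_lin : forall (a : K) x y, carrier x -> carrier y ->
    carrier (a *: x + y) ;
  carrier_closed : closed carrier }.

Definition carrier_pred (V : normedModType K) (W : closedSubspace V)
  : {pred V} := fun x => x \in (W : set V).

Section instances.
Variables (V : normedModType K) (W : closedSubspace V).

Lemma carrier_submod_closed : submod_closed (carrier_pred W).
Proof.
split=> [|a x y]; rewrite !unfold_in !inE; first exact: carrier0.
exact: carrier_lin.
Qed.

HB.instance Definition _ :=
  GRing.isSubmodClosed.Build K V (carrier_pred W) carrier_submod_closed.

End instances.

Definition subspace_type (V : normedModType K) (W : closedSubspace V) :=
  {x : V | x \in carrier_pred W}.

Section subspace_structure.
Variables (V : normedModType K) (W : closedSubspace V).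
Local Notation T := (subspace_type W).

HB.instance Definition _ := [isSub of T for sval].
HB.instance Definition _ := [Choice of T by <:].
HB.instance Definition _ := [SubChoice_isSubLmodule of T by <:].

Definition sub_norm (x : T) : K := `|val x|.

Lemma sub_norm_triangle x y : sub_norm (x + y) <= sub_norm x + sub_norm y.
Proof. exact: ler_normD. Qed.

Lemma sub_normZ (a : K) x : sub_norm (a *: x) = `|a| * sub_norm x.
Proof. exact: normrZ. Qed.

Lemma sub_norm_eq0 x : sub_norm x = 0 -> x = 0.
Proof. by move=> /eqP; rewrite normr_eq0 => /eqP x0; apply: val_inj. Qed.

HB.instance Definition _ :=
  Lmodule_isNormed.Build K T sub_norm_triangle sub_normZ sub_norm_eq0.

Lemma sub_normE (x : T) : `|x| = `|val x|. Proof. by []. Qed.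

End subspace_structure.
End closed_subspaces.

Section subspace_complete.
Variables (K : numFieldType) (V : completeNormedModType K).
Variable W : closedSubspace V.
Local Notation T := (subspace_type W).

Lemma subspace_cauchy_cvg (F : set_system T) :
  ProperFilter F -> cauchy F -> cvg F.
Proof.
move=> FF Fc.
have Gc : cauchy (val @ F : set_system V).
  apply/cauchy_ballP => e e0; move/cauchy_ballP : Fc => /(_ _ e0).
  rewrite !near_simpl => -[[A B] /= [FA FB] AB].
  exists (val @` A, val @` B) => /=.
    split.
      by apply: filterS FA => x Ax; exists x.
    by apply: filterS FB => x Ax; exists x.
  move=> [_ _] /= [[x Ax <-] [y By <-]].
  by have := AB (x, y) (conj Ax By); rewrite -!ball_normE.
have [l Gl] : exists l : V, (val @ F : set_system V) --> l.
  by apply/cvg_ex; exact: cauchy_cvg.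
have Wl : l \in carrier_pred W.
  apply/mem_set.
  apply: (@closed_cvg T V F _ (val : T -> V) (carrier W)
    (@carrier_closed _ _ W) _ l Gl).
  by apply: nearW => x; apply/set_mem; exact: (valP x).
apply/cvg_ex; exists (exist _ l Wl : T).
apply/cvgrPdist_lt => e e0.
by move/cvgrPdist_lt : Gl => /(_ _ e0).
Qed.

HB.instance Definition _ := Uniform_isComplete.Build T subspace_cauchy_cvg.

End subspace_complete.

Section bounded_operators.
Variables (R : realType) (k : scalar_kind).
Local Notation K := (scalarField R k).

Section hom.
Variables X Y : normedModType K.

Definition bounded_op_pred : {pred X -> Y} := fun f =>
  `[< linear f /\ exists M : K, forall x, `|f x| <= M * `|x| >].

Lemma bounded_op_submod_closed : submod_closed bounded_op_pred.
Proof.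
split=> [|a f g].
  apply/asboolP; split=> [b x y|]; first by rewrite scaler0 addr0.
  by exists 0 => x; rewrite normr0 mul0r.
move=> /asboolP[lf [M Mf]] /asboolP[lg [N Ng]]; apply/asboolP; split.
  move=> b x y; rewrite !fctE lf lg !scalerDr !scalerA mulrC.
  by rewrite -!addrA; congr (_ + _); rewrite addrCA.
exists (`|a| * M + N) => x; rewrite !fctE (le_trans (ler_normD _ _))//.
by rewrite mulrDl lerD// normrZ -mulrA ler_wpM2l.
Qed.

HB.instance Definition _ := GRing.isSubmodClosed.Build K (X -> Y)
  bounded_op_pred bounded_op_submod_closed.

Record bounded_op := BoundedOp {
  bounded_op_val :> X -> Y ;
  _ : bounded_op_val \in bounded_op_pred }.

HB.instance Definition _ := [isSub for bounded_op_val].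
HB.instance Definition _ := [Choice of bounded_op by <:].
HB.instance Definition _ := [SubChoice_isSubLmodule of bounded_op by <:].

Implicit Types f g : bounded_op.

Lemma bounded_op_linear f : linear f.
Proof. by case: f => f /= /asboolP[]. Qed.

HB.instance Definition _ f :=
  GRing.isLinear.Build K X Y _ f (bounded_op_linear f).

Lemma bounded_op_bounded f : exists M : K, forall x, `|f x| <= M * `|x|.
Proof. by case: f => f /= /asboolP[]. Qed.

Definition op_norm f : K := supremum 0 [set `|f x| | x in [set x | `|x| <= 1]].

Lemma op_norm_nonempty f : [set `|f x| | x in [set x | `|x| <= 1]] !=set0.
Proof. by exists `|f 0|, 0 => //=; rewrite normr0. Qed.

Lemma op_norm_has_sup f :
  supremums [set `|f x| | x in [set x | `|x| <= 1]] !=set0.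
Proof.
apply: scalar_sup; first exact: op_norm_nonempty.
  by move=> _ [x _ <-].
have [M fM] := bounded_op_bounded f.
exists `|M| => _ [x /= x1 <-].
have r : M * `|x| \is Num.real by rewrite -(ler_real (fM x)) normr_real.
rewrite (le_trans (fM x))// (le_trans (real_ler_norm r))//.
by rewrite normrM normr_id ler_piMr.
Qed.

Lemma op_norm_le1 f x : `|x| <= 1 -> `|f x| <= op_norm f.
Proof. by move=> x1; apply: supremum_ub; [exact: op_norm_has_sup|exists x]. Qed.

Lemma op_norm_leP f M : (forall x, `|x| <= 1 -> `|f x| <= M) -> op_norm f <= M.
Proof.
move=> fM; apply: supremum_le; [exact: op_norm_nonempty|exact: op_norm_has_sup|].
by move=> _ [x x1 <-]; exact: fM.
Qed.

Lemma op_norm_ge0 f : 0 <= op_norm f.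
Proof. by rewrite (le_trans _ (@op_norm_le1 f 0 _)) ?normr0. Qed.

Lemma op_norm_le f x : `|f x| <= op_norm f * `|x|.
Proof.
have [->|x0] := eqVneq x 0; first by rewrite linear0 !normr0 mulr0.
have nx0 : 0 < `|x| by rewrite normr_gt0.
have := @op_norm_le1 f (`|x|^-1 *: x).
rewrite linearZ/= !normrZ normfV normr_id mulVf ?gt_eqF// => /(_ (lexx _)).
by rewrite ler_pdivrMl// mulrC.
Qed.

Lemma op_norm_triangle f g : op_norm (f + g) <= op_norm f + op_norm g.
Proof.
apply: op_norm_leP => x x1; rewrite (le_trans (ler_normD _ _))//.
by rewrite lerD// op_norm_le1.
Qed.

Lemma op_normZ (a : K) f : op_norm (a *: f) = `|a| * op_norm f.
Proof.
have h b g : op_norm (b *: g) <= `|b| * op_norm g.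
  by apply: op_norm_leP => x x1; rewrite normrZ ler_wpM2l// op_norm_le1.
apply/le_anti; rewrite h /=.
have [->|a0] := eqVneq a 0; first by rewrite normr0 mul0r op_norm_ge0.
rewrite -ler_pdivlMl ?normr_gt0// -normfV (le_trans _ (h _ _))//.
by rewrite scalerA mulVf// scale1r.
Qed.

Lemma op_norm_eq0 f : op_norm f = 0 -> f = 0.
Proof.
move=> f0; apply: val_inj; apply/funext => x /=; apply/eqP.
by rewrite -normr_le0 (le_trans (op_norm_le f x))// f0 mul0r.
Qed.

HB.instance Definition _ :=
  Lmodule_isNormed.Build K bounded_op op_norm_triangle op_normZ op_norm_eq0.

Lemma op_normE f : `|f| = op_norm f. Proof. by []. Qed.

End hom.
End bounded_operators.

Section quotient_spaces.
Variables (R : realType) (k : scalar_kind).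
Local Notation K := (scalarField R k).
Variables (V : normedModType K) (W : closedSubspace V).

Definition quotient_space := Quotient.quot (carrier_pred W).
Local Notation Q := quotient_space.

HB.instance Definition _ := GRing.Zmodule.on Q.

Definition quot_proj (x : V) : Q := \pi_(Quotient.quot (carrier_pred W)) x.

Lemma quot_projP x y : quot_proj x = quot_proj y <-> carrier W (x - y).
Proof.
rewrite /quot_proj; split => [/eqP|Wxy].
  by rewrite -Quotient.idealrBE => /set_mem.
by apply/eqP; rewrite -Quotient.idealrBE; apply/mem_set.
Qed.

Lemma quot_projD x y : quot_proj (x + y) = quot_proj x + quot_proj y.
Proof. by rewrite /quot_proj piE. Qed.

Lemma quot_proj_surj (q : Q) : exists x, quot_proj x = q.
Proof. by exists (repr q); rewrite /quot_proj reprK. Qed.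

Definition quot_scale (a : K) (q : Q) : Q := quot_proj (a *: repr q).

Lemma quot_scale_proj a x : quot_scale a (quot_proj x) = quot_proj (a *: x).
Proof.
apply/quot_projP; rewrite -scalerBr -[_ *: _]addr0.
by apply: carrier_lin (carrier0 W); apply/quot_projP; rewrite /quot_proj reprK.
Qed.

Lemma quot_scaleA a b q : quot_scale a (quot_scale b q) = quot_scale (a * b) q.
Proof. by have [x <-] := quot_proj_surj q; rewrite !quot_scale_proj scalerA. Qed.

Lemma quot_scale1 : left_id 1 quot_scale.
Proof.
by move=> q; have [x <-] := quot_proj_surj q; rewrite quot_scale_proj scale1r.
Qed.

Lemma quot_scaleDr : right_distributive quot_scale +%R.
Proof.
move=> a p q; have [x <-] := quot_proj_surj p; have [y <-] := quot_proj_surj q.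
by rewrite -quot_projD !quot_scale_proj scalerDr quot_projD.
Qed.

Lemma quot_scaleDl q : {morph quot_scale^~ q : a b / a + b}.
Proof.
move=> a b; have [x <-] := quot_proj_surj q.
by rewrite !quot_scale_proj scalerDl quot_projD.
Qed.

HB.instance Definition _ := GRing.Zmodule_isLmodule.Build K Q
  quot_scaleA quot_scale1 quot_scaleDr quot_scaleDl.

Lemma quot_projZ (a : K) x : quot_proj (a *: x) = a *: quot_proj x.
Proof. by rewrite -quot_scale_proj. Qed.

Definition dist_carrier (x : V) : K :=
  infimum 0 [set `|x - w| | w in carrier W].

Definition quot_norm (q : Q) : K := dist_carrier (repr q).

Lemma dist_carrier_has_inf x : infimums [set `|x - w| | w in carrier W] !=set0.
Proof.
apply: scalar_inf; first by exists `|x - 0|, 0 => //; exact: carrier0.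
by move=> _ [w _ <-].
Qed.

Lemma dist_carrier_le x w : carrier W w -> dist_carrier x <= `|x - w|.
Proof.
by move=> Ww; apply: infimum_lb; [exact: dist_carrier_has_inf|exists w].
Qed.

Lemma dist_carrier_ge x m : (forall w, carrier W w -> m <= `|x - w|) ->
  m <= dist_carrier x.
Proof.
move=> h; apply: infimum_ge; last by move=> _ [w Ww <-]; exact: h.
- by exists `|x - 0|, 0 => //; exact: carrier0.
- exact: dist_carrier_has_inf.
Qed.

Lemma dist_carrier_ge0 x : 0 <= dist_carrier x.
Proof. by apply: dist_carrier_ge. Qed.

Lemma carrierD x y : carrier W x -> carrier W y -> carrier W (x + y).
Proof. by rewrite -{2}[x]scale1r; exact: carrier_lin. Qed.

Lemma carrierZ (a : K) x : carrier W x -> carrier W (a *: x).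
Proof.
by move=> Wx; rewrite -[_ *: _]addr0; apply: carrier_lin (carrier0 W).
Qed.

Lemma dist_carrier_proj x y : quot_proj x = quot_proj y ->
  dist_carrier x = dist_carrier y.
Proof.
suff h u v : carrier W (u - v) -> dist_carrier u <= dist_carrier v.
  move=> xy; apply/le_anti/andP.
  by split; apply: h; apply/quot_projP.
move=> Wuv; apply: dist_carrier_ge => w Ww.
have -> : v - w = u - (u - v + w) by rewrite opprD opprB addrA addrCA subrr addr0.
by apply: dist_carrier_le; exact: carrierD.
Qed.

Lemma quot_norm_proj x : quot_norm (quot_proj x) = dist_carrier x.
Proof. by apply: dist_carrier_proj; rewrite /quot_proj reprK. Qed.

Lemma dist_carrier_approx x (e : K) : 0 < e ->
  exists2 w, carrier W w & `|x - w| < dist_carrier x + e.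
Proof.
move=> e0; apply: contrapT => h.
suff : dist_carrier x + e <= dist_carrier x by rewrite gerDl lt_geF.
apply: dist_carrier_ge => w Ww; rewrite real_leNgt ?ger0_real//.
  by apply/negP => xw; apply: h; exists w.
by rewrite addr_ge0 ?dist_carrier_ge0 ?ltW.
Qed.

Lemma dist_carrierD x y :
  dist_carrier (x + y) <= dist_carrier x + dist_carrier y.
Proof.
apply/ler_addgt0Pr => e e0; have e20 : 0 < e / 2 by rewrite divr_gt0.
have [v Wv xv] := dist_carrier_approx x e20.
have [w Ww yw] := dist_carrier_approx y e20.
rewrite (le_trans (dist_carrier_le _ (carrierD Wv Ww)))//.
rewrite opprD addrACA (le_trans (ler_normD _ _))// [e]splitr addrACA.
by rewrite lerD// ltW.
Qed.

Lemma dist_carrierZ (a : K) x : dist_carrier (a *: x) = `|a| * dist_carrier x.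
Proof.
have h b y : b != 0 -> `|b| * dist_carrier y <= dist_carrier (b *: y).
  move=> b0; apply: dist_carrier_ge => w Ww.
  have -> : b *: y - w = b *: (y - b^-1 *: w).
    by rewrite scalerBr scalerA mulfV// scale1r.
  by rewrite normrZ ler_wpM2l// dist_carrier_le//; exact: carrierZ.
have [->|a0] := eqVneq a 0.
  rewrite scale0r normr0 mul0r; apply/le_anti; rewrite dist_carrier_ge0 andbT.
  by rewrite (le_trans (dist_carrier_le _ (carrier0 W)))// subrr normr0.
apply/le_anti; rewrite h// andbT.
rewrite -ler_pdivrMl ?normr_gt0// -normfV (le_trans (h _ _ _)) ?invr_eq0//.
by rewrite scalerA mulVf// scale1r.
Qed.

Lemma quot_norm_triangle p q : quot_norm (p + q) <= quot_norm p + quot_norm q.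
Proof.
have [x <-] := quot_proj_surj p; have [y <-] := quot_proj_surj q.
by rewrite -quot_projD !quot_norm_proj; exact: dist_carrierD.
Qed.

Lemma quot_normZ (a : K) q : quot_norm (a *: q) = `|a| * quot_norm q.
Proof.
have [x <-] := quot_proj_surj q.
by rewrite -quot_projZ !quot_norm_proj dist_carrierZ.
Qed.

Lemma quot_norm_eq0 q : quot_norm q = 0 -> q = 0.
Proof.
have [x <-] := quot_proj_surj q; rewrite quot_norm_proj => x0.
have -> : 0 = quot_proj 0 by rewrite -(scale0r (0 : V)) quot_projZ scale0r.
apply/quot_projP; rewrite subr0; apply: carrier_closed => B.
move=> /nbhs_normP[e /= e0 xB]; have [w Ww] := dist_carrier_approx x e0.
by rewrite x0 add0r => xw; exists w; split=> //; apply: xB.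
Qed.

HB.instance Definition _ :=
  Lmodule_isNormed.Build K Q quot_norm_triangle quot_normZ quot_norm_eq0.

Lemma quot_normE x :
  `|quot_proj x| = infimum 0 [set `|x - w| | w in carrier W].
Proof. exact: quot_norm_proj. Qed.

End quotient_spaces.

Section compact_operators.
Variable K : numFieldType.

Lemma precompactP (V : completeNormedModType K) (A : set V) :
  precompact A <-> forall e : K, 0 < e ->
    exists s : seq V, forall x, A x -> exists2 c, c \in s & `|c - x| < e.
Proof.
rewrite precompactE; split => [|h].
  rewrite compact_cover => + e e0 => /(_ V setT (fun c => ball c e))[].
  - by move=> c _; exact: ball_open.
  - by move=> x _; exists x => //; exact: ballxx.
  move=> D _ AD; exists (enum_fset D) => x /subset_closure /AD [c /= cD].
  by rewrite -ball_normE => cx; exists c.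
rewrite compact_ultra => F FF FA.
have Fc : cauchy F.
  apply: cauchy_exP => e e0; apply: contrapT => hF.
  have [s sA] := h _ (divr_gt0 e0 (ltr0n K 2)).
  have : F (~` closure A).
    have FC c : F (~` ball c e).
      have [Fc|//] := in_ultra_setVsetC (ball c e) FF.
      by exfalso; apply: hF; exists c.
    have : F (\bigcap_(c in [set` [fset c in s]%fset]) ~` ball c e).
      exact: filter_bigI.
    apply: filterS => x xs /(_ (ball x (e / 2))) [|y [Ay]].
      by apply: nbhsx_ballx; rewrite divr_gt0.
    rewrite -ball_normE /= => xy; have [c cs cy] := sA _ Ay.
    have := xs c; apply; first by rewrite /= inE.
    rewrite -ball_normE /= [e]splitr.
    rewrite -(subrK y c) -addrA (le_lt_trans (ler_normD _ _))// ltrD//.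
    by rewrite distrC.
  by move=> /(filterI FA); rewrite setICr => /filter_not_empty.
have [l Fl] : exists l : V, F --> l by apply/cvg_ex; exact: cauchy_cvg.
exists l; split => //.
exact: (@closed_cvg V V F _ id (closure A) (@closed_closure _ A) FA l Fl).
Qed.

End compact_operators.

Section compact_op_space.
Variables (R : realType) (k : scalar_kind).
Local Notation K := (scalarField R k).
Variables (X : normedModType K) (Y : completeNormedModType K).

Definition compact_op : set (bounded_op X Y) :=
  [set f | precompact [set f x | x in [set x | `|x| <= 1]]].

Lemma compact_op0 : compact_op 0.
Proof.
apply/precompactP => e e0; exists [:: 0] => _ [x _ <-].
by exists 0; rewrite ?mem_head// subr0 normr0.
Qed.

Lemma compact_op_lin (a : K) f g :
  compact_op f -> compact_op g -> compact_op (a *: f + g).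
Proof.
move=> /precompactP cf /precompactP cg; apply/precompactP => e e0.
have e20 : 0 < e / 2 by rewrite divr_gt0.
have a0 : 0 < `|a| + 1 by rewrite ltr_wpDl.
have [s sf] := cf _ (divr_gt0 e20 a0); have [t tg] := cg _ e20.
exists [seq a *: c + d | c <- s, d <- t] => _ [x x1 <-].
have [|c cs cx] := sf (f x); first by exists x.
have [|d dt dx] := tg (g x); first by exists x.
exists (a *: c + d); first by apply/allpairsP; exists (c, d).
have -> : a *: c + d - (a *: f + g) x = a *: (c - f x) + (d - g x).
  by rewrite scalerBr addrACA -opprD.
rewrite (le_lt_trans (ler_normD _ _))// [e]splitr ler_ltD// normrZ.
rewrite (@le_trans _ _ ((`|a| + 1) * `|c - f x|))//.
  by rewrite ler_wpM2r// lerDl.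
by rewrite -ler_pdivlMl// mulrC ltW.
Qed.

Lemma compact_op_closed : closed compact_op.
Proof.
move=> f clf; apply/precompactP => e e0.
have e20 : 0 < e / 2 by rewrite divr_gt0.
have [g [/precompactP cg]] := clf _ (nbhsx_ballx f _ e20).
rewrite -ball_normE /= => fg; have [s sg] := cg _ e20.
exists s => _ [x x1 <-]; have [|c cs cx] := sg (g x); first by exists x.
exists c => //; rewrite -(subrK (g x) c) -addrA [e]splitr.
rewrite (le_lt_trans (ler_normD _ _))// ltrD// distrC.
have -> : f x - g x = (f - g) x by [].
by rewrite (le_lt_trans _ fg)// op_normE op_norm_le1.
Qed.

Definition compact_ops : closedSubspace (bounded_op X Y) :=
  ClosedSubspace compact_op0 compact_op_lin compact_op_closed.

End compact_op_space.

Section definitions.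
Variables (R : realType) (k : scalar_kind).
Local Notation K := (scalarField R k).

(* [quot_norm] is the distance of a representative to the subspace, so the norm
   below is the essential norm (see [calkin_normE]). *)
Definition calkin (X : completeNormedModType K) : normedModType K :=
  quotient_space (compact_ops X X).

Lemma calkin_normE (X : completeNormedModType K) (T : bounded_op X X) :
  `|quot_proj (compact_ops X X) T| =
  infimum 0 [set `|T - C| | C in compact_op (Y := X)].
Proof. exact: quot_normE. Qed.

(* The radii are positive, hence real also when [K] is the complex field; the
   condition [b.2 <= `|b.1|] says that the open ball misses the origin. The
   countable family may be finite or empty. *)
Definition BCP (Z : normedModType K) : Prop :=
  exists B : set (Z * K),
    [/\ countable B,
        forall b, B b -> 0 < b.2 <= `|b.1| &
        [set z : Z | `|z| = 1] `<=` \bigcup_(b in B) ball b.1 b.2].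

Definition lin_span (V : normedModType K) (A : set V) : set V :=
  [set v | exists (n : nat) (c : 'I_n -> K) (w : 'I_n -> V),
     (forall i, A (w i)) /\ v = \sum_(i < n) c i *: w i].

Definition finite_dimensional (V : normedModType K) : Prop :=
  exists2 A : set V, finite_set A & lin_span A = setT.

Definition dual_space (V : normedModType K) : normedModType K := bounded_op V K^o.

Section bases.
Variable Y : normedModType K.
Implicit Types (e : nat -> Y) (a b : nat -> K).

Definition expansion e a (x : Y) : Prop :=
  series (fun n => a n *: e n) @ \oo --> x.

Definition schauder_basis e : Prop :=
  forall x, exists! a, expansion e a x.

Definition unconditional_with e (C : K) : Prop :=
  forall a b x y, (forall n, `|a n| <= `|b n|) ->
    expansion e a x -> expansion e b y -> `|x| <= C * `|y|.

Definition biorthogonal e (f : nat -> dual_space Y) : Prop :=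
  forall i j, (f i : bounded_op Y K^o) (e j) = (i == j)%:R.

Definition unconditional_constant e (C : K) : Prop :=
  [/\ 1 <= C, unconditional_with e C &
      forall D : K, 1 <= D -> unconditional_with e D -> C <= D].

Definition one_unconditional e : Prop := unconditional_constant e 1.

(* A biorthogonal sequence in the dual is unique when [e] is a Schauder basis
   (the span of [e] is dense), and exists when moreover [Y] is complete. *)
Definition shrinking e : Prop :=
  exists2 f : nat -> dual_space Y,
    biorthogonal e f & closure (lin_span (range f)) = setT.

End bases.

(* The range of a bounded projection is closed, so taking [X] to be a closed
   subspace loses nothing. *)
Definition one_complemented (Y : normedModType K) (X : closedSubspace Y) :
    Prop :=
  exists P : bounded_op Y Y,
    [/\ forall y, P (P y) = P y, range P = carrier X & `|P| = 1].

End definitions.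

(* Main.v *)
Require Import Defs.
From mathcomp Require Import all_boot all_order all_algebra.
From mathcomp Require Import all_classical all_reals all_analysis.
From mathcomp Require Import complex ring.

(* For every operator T on X and every N there is w in the unit ball of Y,
   supported on the coordinates >= N, such that ||T P w|| is almost the
   essential norm of T: subtract from T the finite-rank operator T P P_N, with
   P_N the N-th partial sum projection. Since the basis is shrinking, compact
   operators on Y and P_m P for fixed m become uniformly small on such vectors
   as N grows. Hence, given centres T_1, T_2, ..., vectors x_j = P w_j can be
   picked, each T_i and the identity (called T_0) being served infinitely
   often, that are almost supported on consecutive blocks. Let A be the union
   of the blocks serving T_0 and D_A the diagonal projection onto A, a
   contraction by 1-unconditionality. The operator S = P D_A is a contraction
   almost fixing the x_j that serve T_0, so that its essential norm is 1, and
   almost killing those that serve T_i, so that S - T_i has essential norm at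
   least ||T_i||_e: S lies in no ball centred at T_i that misses the origin. *)

Set Implicit Arguments.
Unset Strict Implicit.
Unset Printing Implicit Defensive.
Import Order.TTheory GRing.Theory Num.Theory.
Import numFieldNormedType.Exports.
Local Open Scope classical_set_scope.
Local Open Scope ring_scope.

(** * Small reciprocals and finite nets in the real or complex scalars *)

Section scalars.
Variables (R : realType) (k : scalar_kind).
Local Notation K := (scalarField R k).

(** A positive complex scalar has zero imaginary part, so the complex case reduces to the real
    one. *)
Lemma scalar_archimedean (eps : K) : 0 < eps ->
  exists n : nat, forall m, (n <= m)%N -> m.+1%:R^-1 < eps.
Proof.
have real_arch (r : R) : 0 < r ->
    exists n : nat, forall m, (n <= m)%N -> m.+1%:R^-1 < r.
  move=> r0; exists (Num.trunc r^-1) => m nm.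
  rewrite invf_plt ?posrE// (lt_le_trans (truncnS_gt _))// ler_nat.
  by rewrite ltnS.
case: k eps => eps; first exact: real_arch.
case: eps => r i; rewrite ltcE /= => /andP[/eqP i0 /real_arch[n nr]].
exists n => m /nr; rewrite i0 -ltcR.
by rewrite -[X in X < _ -> _]/((_%:C)%C) fmorphV rmorph_nat.
Qed.

(** Round [|x|] down to a multiple of [r], then restore the sign. *)
Lemma real_bounded_net (M r : R) : 0 < r ->
  exists s : seq R, forall x, `|x| <= M -> exists2 c, c \in s & `|c - x| < r.
Proof.
move=> r0; pose N := (Num.trunc (M / r)).+1.
pose t := [seq i%:R * r | i <- iota 0 N].
exists (t ++ map -%R t) => x xM.
have y0 : 0 <= `|x| / r by rewrite divr_ge0// ltW.
pose n := Num.trunc (`|x| / r).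
have nt : n%:R * r \in t.
  apply/mapP; exists n => //; rewrite mem_iota /= add0n ltnS.
  by apply: le_truncn; rewrite ler_pM2r// invr_gt0.
have /andP[n1 n2] := truncn_itv y0.
have nx : `|n%:R * r - `|x| | < r.
  rewrite distrC ger0_norm ?subr_ge0 -?ler_pdivlMr//.
  rewrite ltrBlDr (_ : r + _ = n.+1%:R * r) -?ltr_pdivrMr//.
  by rewrite -natr1 mulrDl mul1r addrC.
have [x0|/ltW x0] := leP 0 x.
  exists (n%:R * r); first by rewrite mem_cat nt.
  by move: nx; rewrite (ger0_norm x0).
exists (- (n%:R * r)); first by rewrite mem_cat map_f ?orbT.
by rewrite -opprD normrN; move: nx; rewrite (ler0_norm x0) opprK.
Qed.

(** In the complex case the modulus bounds the real and imaginary parts, and the product of two real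
    nets for [r / 2] works. *)
Lemma scalar_bounded_net (M eps : K) : 0 < eps ->
  exists s : seq K, forall x, `|x| <= M -> exists2 c, c \in s & `|c - x| < eps.
Proof.
case: k M eps => M eps; first exact: real_bounded_net.
case: eps => r i; rewrite ltcE /= => /andP[/eqP i0 r0].
have r20 : 0 < r / 2 by rewrite divr_gt0.
have [s sM] := real_bounded_net (complex.Re M) r20.
exists [seq (a +i* b)%C | a <- s, b <- s] => -[x y] xyM.
have reM (z : R) : (`|z|%:C)%C <= `|(x +i* y)%C| -> `|z| <= complex.Re M.
  move=> /le_trans/(_ xyM); clear.
  by case: M => m n; rewrite lecE /= => /andP[].
have [|a sa ax] := sM x; first by apply: reM; exact: (normc_ge_Re (x +i* y)%C).
have [|b sb by_] := sM y.
  apply: reM; rewrite normc_def /= lecR -sqrtr_sqr ler_wsqrtr// lerDr.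
  exact: sqr_ge0.
exists (a +i* b)%C; first by apply/allpairsP; exists (a, b).
have -> : ((a +i* b) - (x +i* y))%C = (((a - x) +i* 0) + (0 +i* (b - y)))%C.
  by apply/eqP; rewrite eq_complex /=; apply/andP; split; apply/eqP; ring.
apply: le_lt_trans (ler_normD _ _) _.
rewrite !normc_def /= !expr0n /= addr0 add0r !sqrtr_sqr.
by rewrite i0 -[X in X < _]rmorphD -[X in _ < X]/((r%:C)%C) ltcR [r]splitr ltrD.
Qed.

End scalars.

(** * Coordinates in a Schauder basis *)

Section expansions.
Variables (R : realType) (k : scalar_kind).
Local Notation K := (scalarField R k).
Variables (Y : normedModType K) (e : nat -> Y).
Implicit Types (a b : nat -> K) (x y : Y).

Lemma expansionP a x : expansion e a x <->
  (fun n => \sum_(0 <= i < n) a i *: e i) @ \oo --> x.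
Proof. by []. Qed.

Lemma expansion_lin (c : K) a b x y : expansion e a x -> expansion e b y ->
  expansion e (fun n => c * a n + b n) (c *: x + y).
Proof.
move=> /expansionP ax /expansionP bY; apply/expansionP.
have -> : (fun n => \sum_(0 <= i < n) (c * a i + b i) *: e i) =
    c \*: (fun n => \sum_(0 <= i < n) a i *: e i) +
    (fun n => \sum_(0 <= i < n) b i *: e i).
  apply/funext => n; rewrite !fctE /=.
  rewrite scaler_sumr -big_split /=.
  by apply: eq_bigr => i _; rewrite scalerDl scalerA.
by apply: cvgD => //; exact: cvgZl_tmp.
Qed.

Lemma expansion_finite a m n : (m <= n)%N ->
  expansion e (fun i => if (m <= i < n)%N then a i else 0)
    (\sum_(m <= i < n) a i *: e i).
Proof.
move=> mn; apply/expansionP; apply: cvg_near_cst; near=> N.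
have nN : (n <= N)%N by near: N; exact: nbhs_infty_ge.
rewrite (big_cat_nat (leq0n m) (leq_trans mn nN)) /=.
rewrite big_nat_cond big1 ?add0r; last first.
  by move=> i /andP[/andP[_ im] _]; rewrite leqNgt im scale0r.
rewrite (big_cat_nat mn nN) /= [X in _ + X]big_nat_cond.
rewrite [X in _ + X]big1 ?addr0; last first.
  by move=> i /andP[/andP[ni _] _]; rewrite [(i < n)%N]ltnNge ni andbF scale0r.
by apply: eq_big_nat => i ->.
Unshelve. all: by end_near. Qed.

Hypothesis basis_e : schauder_basis e.

Definition coef x : nat -> K := sval (cid (basis_e x)).

Lemma coef_expansion x : expansion e (coef x) x.
Proof. by rewrite /coef; case: cid => a []. Qed.
Arguments coef_expansion : clear implicits.

Lemma coef_unique x a : expansion e a x -> coef x = a.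
Proof. by rewrite /coef; case: cid => b [? h]; exact: h. Qed.

Lemma coef_lin (c : K) x y n : coef (c *: x + y) n = c * coef x n + coef y n.
Proof.
by rewrite (coef_unique (expansion_lin (coef_expansion x) (coef_expansion y))).
Qed.

Lemma coef0 n : coef 0 n = 0.
Proof.
have := coef_lin 1 0 0 n; rewrite scaler0 addr0 mul1r => /eqP.
by rewrite -subr_eq0 opprD addrA subrr add0r oppr_eq0 => /eqP.
Qed.

Lemma coefD x y n : coef (x + y) n = coef x n + coef y n.
Proof. by rewrite -{1}[x]scale1r coef_lin mul1r. Qed.

Lemma coefZ c x n : coef (c *: x) n = c * coef x n.
Proof. by rewrite -[_ *: _]addr0 coef_lin coef0 addr0. Qed.

Lemma coefB x y n : coef (x - y) n = coef x n - coef y n.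
Proof. by rewrite coefD -scaleN1r coefZ mulN1r. Qed.

Lemma coef_inj x y : coef x =1 coef y -> x = y.
Proof.
move=> /funext xy; have := coef_expansion y; rewrite -xy => yx.
exact: (norm_cvg_unique (coef_expansion x) yx).
Qed.

(** Otherwise the zero vector would have a second expansion, with coefficient 1 at [n]. *)
Lemma basis_neq0 n : e n != 0.
Proof.
apply/eqP => en0; have := coef_unique (@expansion_finite (fun=> 1) _ _ (leqnSn n)).
rewrite big_nat1 scale1r en0 => /(congr1 (@^~ n)).
by rewrite coef0 leqnn ltnSn /= => /eqP; rewrite eq_sym oner_eq0.
Qed.

Definition tail N x := forall i, (i < N)%N -> coef x i = 0.

Lemma tailS M N x : (M <= N)%N -> tail N x -> tail M x.
Proof. by move=> MN tx i iM; apply: tx; exact: leq_trans iM MN. Qed.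

End expansions.

Arguments coef_expansion {R k Y e} basis_e x : rename.
Arguments coef_unique {R k Y e} basis_e {x a} _ : rename.
Arguments coef_inj {R k Y e} basis_e {x y} _ : rename.

(** * Diagonal projections under unconditionality with constant 1 *)

Section multipliers.
Variables (R : realType) (k : scalar_kind).
Local Notation K := (scalarField R k).
Variables (Y : completeNormedModType K) (e : nat -> Y).
Hypotheses (basis_e : schauder_basis e) (unc_e : unconditional_with e 1).
Implicit Types (A : pred nat) (x y : Y).
Local Notation coef := (coef basis_e).
Local Notation tail := (tail basis_e).

(** Each block of the new series is dominated coefficientwise by the same block of the expansion of
    [x], so the series is Cauchy. *)
Lemma multiplier_exists A x : 
  exists y, expansion e (fun n => (A n)%:R * coef x n) y.
Proof.
apply/cvg_ex/cauchy_cvgP/cauchy_seriesP => eps eps0.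
have /cvgP/cauchy_cvgP/cauchy_seriesP/(_ _ eps0) := coef_expansion basis_e x.
apply: filterS => -[m n] /=; apply: le_lt_trans.
have [nm|/ltnW mn] := leqP n m; first by rewrite !big_geq// normr0.
have := unc_e _ (@expansion_finite _ _ _ e (fun i => (A i)%:R * coef x i) _ _ mn)
  (@expansion_finite _ _ _ e (coef x) _ _ mn).
rewrite mul1r; apply => i; case: ifP => // _.
by rewrite normrM normr_nat ler_piMl// lern1 leq_b1.
Qed.

(** The diagonal projection onto the coordinates in [A]; for an initial segment it is a partial sum
    projection. *)
Definition multiplier A x : Y := sval (cid (multiplier_exists A x)).

Lemma multiplier_expansion A x :
  expansion e (fun n => (A n)%:R * coef x n) (multiplier A x).
Proof. by rewrite /multiplier; case: cid. Qed.

Arguments multiplier_expansion : clear implicits.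

Lemma coef_multiplier A x n : coef (multiplier A x) n = (A n)%:R * coef x n.
Proof. by rewrite (coef_unique basis_e (multiplier_expansion A x)). Qed.

Lemma multiplier_linear A : linear (multiplier A).
Proof.
move=> c x y; apply: (coef_inj basis_e) => n.
by rewrite coef_lin !coef_multiplier coef_lin; ring.
Qed.

Lemma multiplier_contraction A x : `|multiplier A x| <= `|x|.
Proof.
have := unc_e _ (multiplier_expansion A x) (coef_expansion basis_e x).
rewrite mul1r; apply => n.
by rewrite normrM normr_nat ler_piMl// lern1 leq_b1.
Qed.

Local Notation partial n := (multiplier (fun i => i < n)%N).

Lemma partial_sum n x : partial n x = \sum_(i < n) coef x i *: e i.
Proof.
apply: (coef_inj basis_e) => i; rewrite coef_multiplier.
have := coef_unique basis_e (@expansion_finite _ _ _ e (coef x) _ _ (leq0n n)).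
rewrite big_mkord => ->.
by rewrite leq0n /=; case: ifP; rewrite ?mul1r ?mul0r.
Qed.

Lemma partial_cvg x : partial n x @[n --> \oo] --> x.
Proof.
have := coef_expansion basis_e x; rewrite expansionP.
by under eq_fun do rewrite big_mkord -partial_sum.
Qed.

Lemma partial_dist x (eps : K) : 0 < eps ->
  exists n, forall m, (n <= m)%N -> `|x - partial m x| < eps.
Proof.
move=> eps0; have /cvgrPdist_lt/(_ _ eps0) := partial_cvg (x:=x).
by move=> [n _ nP]; exists n => m /nP.
Qed.

Lemma tail_multiplierC N x : tail N (x - partial N x).
Proof.
by move=> i iN; rewrite coefB coef_multiplier iN mul1r subrr.
Qed.

Lemma subr_multiplier A x : x - multiplier A x = multiplier (predC A) x.
Proof.
apply: (coef_inj basis_e) => n; rewrite coefB !coef_multiplier /=.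
by case: (A n) => /=; rewrite mul0r mul1r ?subrr ?subr0.
Qed.

(** Nothing survives inside the block, so only the part before [m] and the part from [n] on
    contribute, and the projection onto [A] contracts both. *)
Lemma multiplier_off_block A x (m n : nat) : (m <= n)%N ->
  (forall i, (m <= i < n)%N -> ~~ A i) ->
  `|multiplier A x| <= `|partial m x| + `|x - partial n x|.
Proof.
move=> mn An; have -> : multiplier A x =
    multiplier A (partial m x) + multiplier A (x - partial n x).
  apply: (coef_inj basis_e) => i.
  rewrite coefD !coef_multiplier coefB !coef_multiplier.
  have [im|mi] := ltnP i m; first by rewrite (leq_trans im mn) !mul1r subrr mulr0 addr0.
  have [i_n|ni] := ltnP i n; last by rewrite !mul0r subr0 mulr0 add0r.
  by rewrite (negbTE (An i _)) ?mi// !mul0r addr0.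
by rewrite (le_trans (ler_normD _ _))// lerD// multiplier_contraction.
Qed.

Lemma multiplier_on_block A x (m n : nat) : (m <= n)%N ->
  (forall i, (m <= i < n)%N -> A i) ->
  `|x - multiplier A x| <= `|partial m x| + `|x - partial n x|.
Proof.
move=> mn An; rewrite subr_multiplier.
by apply: multiplier_off_block => // i /An /= ->.
Qed.

(** The term [coef x n *: e n] is the diagonal projection of [x] onto the single coordinate [n],
    which is a contraction. *)
Lemma coef_bounded n x : `|coef x n| <= `|e n|^-1 * `|x|.
Proof.
have en0 : 0 < `|e n| by rewrite normr_gt0; exact: basis_neq0 basis_e n.
rewrite ler_pdivlMl// mulrC -normrZ.
have -> : coef x n *: e n = partial n.+1 x - partial n x.
  by rewrite !partial_sum big_ord_recr /= addrAC subrr add0r.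
have -> : partial n.+1 x - partial n x = multiplier (pred1 n) x.
  apply: (coef_inj basis_e) => i.
  rewrite coefB !coef_multiplier /= ltnS leq_eqVlt.
  by case: (ltngtP i n) => /=; rewrite ?mul0r ?mul1r ?subrr ?subr0.
exact: multiplier_contraction.
Qed.

Lemma coef_bounded_op n : (coef ^~ n : Y -> K^o) \in @bounded_op_pred R k Y K^o.
Proof.
apply/asboolP; split=> [c x y|]; first exact: coef_lin.
by exists `|e n|^-1 => x; exact: coef_bounded.
Qed.

Definition coef_op n : dual_space Y := BoundedOp (coef_bounded_op n).

Lemma multiplier_bounded_op A : multiplier A \in @bounded_op_pred R k Y Y.
Proof.
apply/asboolP; split; first exact: multiplier_linear.
by exists 1 => x; rewrite mul1r multiplier_contraction.
Qed.

End multipliers.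

(** * Compositions, rank-one operators and finite dimension *)

Section operators.
Variables (R : realType) (k : scalar_kind).
Local Notation K := (scalarField R k).

Lemma bounded_op_sum (V W : normedModType K) n (F : 'I_n -> bounded_op V W) x :
  (\sum_(i < n) F i) x = \sum_(i < n) F i x.
Proof. exact: (big_morph (fun f : bounded_op V W => f x)). Qed.

Lemma comp_op_subproof (U V W : normedModType K) (g : bounded_op V W)
  (f : bounded_op U V) : (g \o f : U -> W) \in @bounded_op_pred R k U W.
Proof.
apply/asboolP; split=> [c x y|]; first by rewrite /= !bounded_op_linear.
exists (op_norm g * op_norm f) => x /=; rewrite (le_trans (op_norm_le _ _))//.
by rewrite -mulrA ler_wpM2l ?op_norm_ge0// op_norm_le.
Qed.

Definition comp_op (U V W : normedModType K) (g : bounded_op V W)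
  (f : bounded_op U V) : bounded_op U W := BoundedOp (comp_op_subproof g f).

Lemma rank_one_subproof (V W : normedModType K) (g : dual_space V) (w : W) :
  (fun x => (g : bounded_op V K^o) x *: w) \in @bounded_op_pred R k V W.
Proof.
apply/asboolP; split=> [c x y|].
  by rewrite bounded_op_linear scalerDl scalerA.
exists (op_norm (g : bounded_op V K^o) * `|w|) => x.
by rewrite normrZ mulrAC ler_wpM2r// (op_norm_le (g : bounded_op V K^o)).
Qed.

Definition rank_one_op (V W : normedModType K) (g : dual_space V) (w : W) :
  bounded_op V W := BoundedOp (rank_one_subproof g w).

(** The unit ball goes to multiples of [w] by a bounded set of scalars, and a finite net of these
    scalars yields one of the image. *)
Lemma rank_one_compact (V : normedModType K) (W : completeNormedModType K)
  (g : dual_space V) (w : W) : compact_op (rank_one_op g w).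
Proof.
apply/precompactP => eps eps0.
(* Adding 1 keeps the divisor positive when [w] is zero. *)
have w0 : 0 < `|w| + 1 by rewrite ltr_wpDl.
have [s sP] := scalar_bounded_net (op_norm (g : bounded_op V K^o))
  (divr_gt0 eps0 w0).
exists [seq c *: w | c <- s] => _ [x x1 <-].
have [c cs cx] := sP _ (op_norm_le1 (g : bounded_op V K^o) x1).
exists (c *: w); first exact: map_f.
rewrite /= -scalerBl normrZ (@le_lt_trans _ _ (`|c - (g : bounded_op V K^o) x| * (`|w| + 1)))//.
  by rewrite ler_wpM2l// lerDl.
by rewrite -ltr_pdivlMr.
Qed.

Lemma lin_span_add (V : normedModType K) (A : set V) v u (c : K) :
  lin_span A u -> lin_span (v |` A) (c *: v + u).
Proof.
move=> [n [a [w [Aw ->]]]].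
exists n.+1, (fun i => oapp a c (unlift ord0 i)),
  (fun i => oapp w v (unlift ord0 i)); split=> [i|].
  by case: unliftP => [j _|_]; [right; exact: Aw|left].
rewrite big_ord_recl unlift_none /=; congr (_ + _).
by apply: eq_bigr => i _; rewrite liftK.
Qed.

(** Dropping one functional enlarges the joint kernel by at most one dimension; from the zero kernel
    of all [N], that many steps reach the whole space. *)
Lemma finite_dimensional_joint_kernel (V : normedModType K)
    (phi : nat -> dual_space V) N :
  (forall x, (forall i, (i < N)%N -> (phi i : bounded_op V K^o) x = 0) -> x = 0) ->
  finite_dimensional V.
Proof.
pose ker n x := forall i, (i < n)%N -> (phi i : bounded_op V K^o) x = 0.
move=> kerN.
have : exists2 A : set V, finite_set A & ker N `<=` lin_span A.
  exists set0 => // x /kerN ->.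
  by exists 0%N, (fun=> 0), (fun=> 0); split=> [[]//|]; rewrite big_ord0.
elim: N {kerN} => [[A fA AS]|N IH [A fA AS]].
  by exists A => //; rewrite -subTset => x _; apply: AS.
apply: IH.
have [[v kv vN]|noV] :=
    pselect (exists2 v, ker N v & (phi N : bounded_op V K^o) v != 0); last first.
  exists A => // x kx; apply: AS => i; rewrite ltnS leq_eqVlt => /predU1P[->|].
    by apply/eqP/negP => /negP xN; apply: noV; exists x.
  exact: kx.
exists (v |` A); first by rewrite finite_setU; split.
move=> x kx; pose c := (phi N : bounded_op V K^o) x / (phi N : bounded_op V K^o) v.
have -> : x = c *: v + (x - c *: v) by rewrite addrC subrK.
apply: lin_span_add; apply: AS => i.
rewrite linearB linearZ /= ltnS leq_eqVlt => /predU1P[->|iN].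
  by rewrite /c /GRing.scale /= divfK// subrr.
by rewrite kx// kv// scaler0 subrr.
Qed.

End operators.

(** * Smallness on tail vectors for a shrinking basis *)

Section tails.
Variables (R : realType) (k : scalar_kind).
Local Notation K := (scalarField R k).
Variables (Y : completeNormedModType K) (e : nat -> Y).
Hypotheses (basis_e : schauder_basis e) (unc_e : unconditional_with e 1).
Hypothesis shrinking_e : shrinking e.
Local Notation coef := (coef basis_e).
Local Notation tail := (tail basis_e).
Local Notation multiplier := (multiplier basis_e unc_e).
Local Notation partial n := (multiplier (fun i => i < n)%N).

(** Both sides agree on long partial sums of [x], hence at [x] by continuity. So the functionals in
    [shrinking] are the coordinate functionals. *)
Lemma biorthogonal_coef (f : nat -> dual_space Y) : biorthogonal e f ->
  forall i x, (f i : bounded_op Y K^o) x = coef x i.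
Proof.
move=> fe i x; set g := (f i : bounded_op Y K^o).
have gp n : (i < n)%N -> g (partial n x) = coef x i.
  move=> i_n; rewrite partial_sum linear_sum /= (bigD1 (Ordinal i_n))//=.
  rewrite big1 ?addr0 => [|j /negbTE ij]; rewrite linearZ /= [g _]fe.
    by rewrite eqxx /GRing.scale /= mulr1.
  by rewrite eq_sym -val_eqE /= in ij; rewrite ij scaler0.
apply/eqP; rewrite -subr_eq0 -normr_le0; apply/ler_addgt0Pr => eps eps0.
have g0 : 0 < op_norm g + 1 by rewrite ltr_wpDl// op_norm_ge0.
have [n nP] := partial_dist basis_e unc_e x (divr_gt0 eps0 g0).
have := nP (maxn n i.+1) (leq_maxl _ _).
rewrite -(gp (maxn n i.+1)) ?leq_maxr// -linearB add0r ltr_pdivlMr// => /ltW.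
apply: le_trans; rewrite (le_trans (op_norm_le _ _))// mulrC.
by rewrite ler_wpM2l// lerDl.
Qed.

(** Within [eps] of [g] lies a finite combination of coordinate functionals, which vanishes on tails
    beyond the indices involved. *)
Lemma dual_tail_small (g : dual_space Y) (eps : K) : 0 < eps ->
  exists N, forall z, `|z| <= 1 -> tail N z ->
    `|(g : bounded_op Y K^o) z| < eps.
Proof.
move=> eps0; have [f fe spanf] := shrinking_e.
have : closure (lin_span (range f)) g by rewrite spanf.
move=> /(_ _ (nbhsx_ballx g _ eps0))[h [[n [c [w [fw hE]]]]]].
rewrite -ball_normE /= => gh.
have {fw} [idx idxE] : {idx : 'I_n -> nat & forall i, f (idx i) = w i}.
  apply: (@choice _ _ (fun i j => f j = w i)) => i.
  by have [j _ fj] := fw i; exists j.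
exists (\max_(i < n) (idx i).+1) => z z1 tz.
have hz : (h : bounded_op Y K^o) z = 0.
  rewrite hE bounded_op_sum big1// => i _.
  rewrite [LHS](_ : _ = c i *: (w i : bounded_op Y K^o) z)//.
  rewrite -idxE (biorthogonal_coef fe) tz ?scaler0//.
  exact: (@leq_bigmax _ (fun i => (idx i).+1) i).
apply: le_lt_trans gh; rewrite -[X in `|X|]subr0 -hz.
exact: (op_norm_le1 (g - h : bounded_op Y K^o)).
Qed.

(** Only [m] coordinates of [G z] occur, and each is a functional of [z], small on tails by
    [dual_tail_small]. *)
Lemma partial_tail_small (G : bounded_op Y Y) m (eps : K) : 0 < eps ->
  exists N, forall z, `|z| <= 1 -> tail N z -> `|partial m (G z)| < eps.
Proof.
elim: m eps => [|m IH] eps eps0.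
  by exists 0%N => z _ _; rewrite partial_sum big_ord0 normr0.
have eps20 : 0 < eps / 2 by rewrite divr_gt0.
have em0 : 0 < `|e m| by rewrite normr_gt0; exact: basis_neq0 basis_e m.
have [N NP] := IH _ eps20.
have [M MP] := dual_tail_small (comp_op (coef_op basis_e unc_e m) G)
  (divr_gt0 eps20 em0).
exists (maxn N M) => z z1 tz.
rewrite partial_sum big_ord_recr /= -(partial_sum basis_e unc_e).
rewrite (le_lt_trans (ler_normD _ _))// [eps]splitr ltrD//.
  by apply: NP => //; apply: tailS tz; exact: leq_maxl.
rewrite normrZ -ltr_pdivlMr//.
by apply: (MP z z1); apply: tailS tz; exact: leq_maxr.
Qed.

Lemma partial_net (s : seq Y) (eps : K) : 0 < eps ->
  exists m, forall c, c \in s -> `|c - partial m c| < eps.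
Proof.
move=> eps0.
(* Quantifying over all larger [m] lets the induction on [s] take a maximum. *)
suff [n nP] : exists n, forall m, (n <= m)%N ->
    forall c, c \in s -> `|c - partial m c| < eps by exists n; exact: nP.
elim: s => [|c s [n nP]]; first by exists 0%N.
have [m mP] := partial_dist basis_e unc_e c eps0.
exists (maxn n m) => l; rewrite geq_max => /andP[nl ml] d.
by rewrite inE => /predU1P[->|]; [exact: mP|exact: nP].
Qed.

(** Some partial sum projection almost fixes a finite net of the image of the unit ball, so [G z] is
    close to its partial sum, which is small on tails. Four errors of a quarter of [eps] add up. *)
Lemma compact_tail_small (G : bounded_op Y Y) (eps : K) : compact_op G ->
  0 < eps -> exists N, forall z, `|z| <= 1 -> tail N z -> `|G z| < eps.
Proof.
move=> /precompactP cG eps0; have e40 : 0 < eps / 2 / 2 by rewrite !divr_gt0.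
have [s sP] := cG _ e40; have [m mP] := partial_net s e40.
have [N NP] := partial_tail_small G m e40.
exists N => z z1 tz; have [|c cs cz] := sP (G z); first by exists z.
have -> : G z = (G z - c) + (c - partial m c) +
    (partial m (c - G z) + partial m (G z)).
  have := linearB (BoundedOp (multiplier_bounded_op basis_e unc_e
    (fun i => (i < m)%N))) c (G z) => /= ->.
  by rewrite [X in _ + X]subrK -[RHS]addrA !subrK.
rewrite [eps]splitr (le_lt_trans (ler_normD _ _))//.
rewrite ltrD// (le_lt_trans (ler_normD _ _))// [X in _ < X]splitr ltrD//.
- by rewrite distrC.
- exact: mP.
- by rewrite (le_lt_trans (multiplier_contraction _ _ _ _)).
- exact: NP.
Qed.

End tails.

(** * The gliding hump construction *)

Section complemented_copy.
Variables (R : realType) (k : scalar_kind).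
Local Notation K := (scalarField R k).
Variables (Y : completeNormedModType K) (e : nat -> Y).
Hypotheses (basis_e : schauder_basis e) (unc_e : unconditional_with e 1).
Hypothesis shrinking_e : shrinking e.
Local Notation tail := (tail basis_e).
Local Notation multiplier := (multiplier basis_e unc_e).
Local Notation partial n := (multiplier (fun i => i < n)%N).

(* The set [A] produced is the union of the blocks of the indices kept. *)
Lemma gliding_hump (G : bounded_op Y Y) (Q : nat -> set Y) (keep : pred nat)
    (eps : nat -> K) : (forall j, 0 < eps j) ->
  (forall j N, exists w, [/\ `|w| <= 1, tail N w & Q j w]) ->
  exists (A : pred nat) (w : nat -> Y), forall j,
    [/\ `|w j| <= 1, tail j (w j), Q j (w j) &
      `|(if keep j then G (w j) else 0) - multiplier A (G (w j))|
        <= eps j + eps j].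
Proof.
move=> eps0 tailQ.
(* The pair [p] is an index with the left end of its block; [r] is the chosen vector with the right
   end. *)
have step (p : nat * nat) : exists r : Y * nat,
    [/\ `|r.1| <= 1, tail p.1 r.1 & Q p.1 r.1] /\
    [/\ `|partial p.2 (G r.1)| < eps p.1,
        `|G r.1 - partial r.2 (G r.1)| < eps p.1 & (p.2 <= r.2)%N].
  have [N NP] := partial_tail_small basis_e unc_e shrinking_e G p.2 (eps0 p.1).
  have [w [w1 tw Qw]] := tailQ p.1 (maxn p.1 N).
  have [n nP] := partial_dist basis_e unc_e (G w) (eps0 p.1).
  exists (w, maxn p.2 n); split; split => //=.
  - by apply: tailS tw; exact: leq_maxl.
  - by apply: NP => //; apply: tailS tw; exact: leq_maxr.
  - by apply: nP; exact: leq_maxr.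
  - exact: leq_maxl.
have {step} [s sP] := choice step.
(* Block [j] runs from [b j] to [b j.+1], so the blocks are consecutive. *)
pose b := fix b j := if j is i.+1 then (s (i, b i)).2 else 0%N.
have b_mono : {homo b : i j / (i <= j)%N}.
  apply: homo_leq => // [j i l|j]; first exact: leq_trans.
  by have [_ [_ _]] := sP (j, b j).
pose A l := `[< exists2 j, keep j & (b j <= l < b j.+1)%N >].
exists A, (fun j => (s (j, b j)).1) => j.
have [[w1 tw Qw] [small_m small_n mn]] := sP (j, b j).
(* The blocks are disjoint, so [A] contains all of block [j] or none of it. *)
have AE l : (b j <= l < b j.+1)%N -> A l = keep j.
  move=> /andP[jl lj]; apply/asboolP/idP => [[i ki /andP[il li]]|kj].
    have [ij|ji|<-//] := ltngtP i j.
      by have := leq_trans (leq_trans li (b_mono _ _ ij)) jl; rewrite ltnn.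
    by have := leq_trans (leq_trans lj (b_mono _ _ ji)) il; rewrite ltnn.
  by exists j => //; rewrite jl.
split => //; apply: le_trans (lerD (ltW small_m) (ltW small_n)).
case: ifP => kj.
  by apply: multiplier_on_block => // l /AE ->.
rewrite sub0r normrN.
by apply: multiplier_off_block => // l /AE ->; rewrite kj.
Qed.

(** * Failure of the BCP for an isometric copy with a contractive projection *)

Variables (Z : completeNormedModType K).
Variables (J : bounded_op Z Y) (q : bounded_op Y Z).
Hypothesis qJ : forall z, q (J z) = z.
Hypothesis norm_J : forall z, `|J z| = `|z|.
Hypothesis norm_q : forall y, `|q y| <= `|y|.
Local Notation compacts := (compact_ops Z Z).

(** The operator [C = T q P_N J] has finite rank, so [T - C] has norm at least the essential norm of
    [T]. If [x] nearly attains it, take [w = J x - P_N J x]: then [T (q w) = (T - C) x]. *)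
Lemma essential_norm_tail (T : bounded_op Z Z) N (eps : K) : 0 < eps ->
  exists w, [/\ `|w| <= 1, tail N w &
    `|quot_proj compacts T| - eps < `|T (q w)|].
Proof.
move=> eps0.
pose C : bounded_op Z Z := \sum_(i < N)
  rank_one_op (comp_op (coef_op basis_e unc_e i) J) (T (q (e i))).
have cC : carrier compacts C.
  rewrite /C; elim/big_ind: _ => [|f g|i _].
  - exact: carrier0.
  - exact: carrierD.
  - exact: rank_one_compact.
have CE x : C x = T (q (partial N (J x))).
  rewrite bounded_op_sum partial_sum !linear_sum /=.
  by apply: eq_bigr => i _; rewrite !linearZ.
have [x [x1 xT]] : exists x, `|x| <= 1 /\
    `|quot_proj compacts T| - eps < `|(T - C) x|.
  apply: contrapT => noX.
  have : op_norm (T - C) <= `|quot_proj compacts T| - eps.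
    apply: op_norm_leP => x x1; rewrite real_leNgt ?normr_real//; last first.
      by rewrite realB ?normr_real// gtr0_real.
    by apply/negP => xT; apply: noX; exists x.
  have : `|quot_proj compacts T| <= op_norm (T - C).
    by rewrite [leLHS]quot_norm_proj; exact: dist_carrier_le.
  by move=> /le_trans h/h; rewrite lerDl oppr_ge0 lt_geF.
exists (J x - partial N (J x)); split.
- rewrite subr_multiplier (le_trans (multiplier_contraction _ _ _ _))//.
  by rewrite norm_J.
- exact: tail_multiplierC.
- suff -> : T (q (J x - partial N (J x))) = (T - C) x by [].
  rewrite [RHS](_ : _ = T x - C x)// CE -linearB; congr (T _).
  by rewrite linearB /= qJ.
Qed.

(** In infinite dimension, [N] functionals have a common nonzero kernel vector; normalized and
    embedded by [J], it is the required [w]. This provides the humps that serve the identity. *)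
Lemma infinite_dimensional_tail N : ~ finite_dimensional Z ->
  exists w, [/\ `|w| <= 1, tail N w & `|q w| = 1].
Proof.
move=> infZ; apply: contrapT => noW; apply: infZ.
apply: (@finite_dimensional_joint_kernel _ _ _
  (fun i => comp_op (coef_op basis_e unc_e i) J) N) => x x0.
apply: contrapT => /eqP xn0; have nx0 : `|x| != 0 by rewrite normr_eq0.
have x1 : `| `|x|^-1 *: x | = 1 by rewrite normrZ normfV normr_id mulVf.
apply: noW; exists (J (`|x|^-1 *: x)); split; first by rewrite norm_J x1.
  by move=> i iN; rewrite linearZ coefZ [X in _ * X](x0 i iN : coef basis_e (J x) i = 0) mulr0.
by rewrite qJ.
Qed.

Lemma calkin_not_BCP : ~ finite_dimensional Z -> ~ BCP (calkin Z).
Proof.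
move=> infZ [B [/countable_injP[f f_inj] B_radius B_cover]].
(* Indices that [f] does not reach on [B] get the dummy pair [(0, 0)]; the final contradiction only
   looks at [f b] with [b] in [B]. *)
pose ball_at n : calkin Z * K := xget (0, 0) [set b | B b /\ f b = n].
have ball_atK b : B b -> ball_at (f b) = b.
  move=> Bb; have [Bc fc] := xgetPex (0, 0)
    (ex_intro (fun c => B c /\ f c = f b) b (conj Bb erefl)).
  by apply: f_inj => //; exact/mem_set.
(* Index 0 is reserved for the identity, written [comp_op q J]; index [n.+1] lifts the centre of
   ball [n]. *)
have [T [T0 TE]] : exists T : nat -> bounded_op Z Z, (forall z, T 0%N z = z) /\
    forall n, quot_proj compacts (T n.+1) = (ball_at n).1.
  exists (fun i => if i is n.+1 then sval (cid (quot_proj_surj (ball_at n).1))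
    else comp_op q J).
  by split=> [z|n]; [exact: qJ|case: cid].
pose d i : K := if i is n.+1 then `|(ball_at n).1| else 1.
have dT i N (eps : K) : 0 < eps ->
    exists w, [/\ `|w| <= 1, tail N w & d i - eps < `|T i (q w)|].
  case: i => [|n] eps0.
    have [w [w1 tw qw]] := infinite_dimensional_tail N infZ.
    by exists w; split; rewrite // T0 qw ltrBlDr ltrDl.
  have [w [w1 tw Tw]] := essential_norm_tail (T n.+1) N eps0.
  by rewrite TE in Tw; exists w; split.
(* [task] takes every value infinitely often, since [task j = i] iff
   [j + 1 = 2 ^ i * m] with [m] odd. *)
pose task j := logn 2 j.+1.
have task_often i N : exists2 j, (N <= j)%N & task j = i.
  have pos : (0 < 2 ^ i * N.*2.+1)%N by rewrite muln_gt0 expn_gt0.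
  exists (2 ^ i * N.*2.+1).-1.
    rewrite -ltnS prednK// (@leq_trans N.*2.+1)//.
      by rewrite ltnS -addnn leq_addr.
    by rewrite leq_pmull// expn_gt0.
  rewrite /task prednK// lognM ?expn_gt0// pfactorK//.
  by rewrite logn_coprime ?addn0// coprime2n /= odd_double.
pose eps j : K := j.+1%:R^-1.
have eps0 j : 0 < eps j by rewrite invr_gt0 ltr0n.
(* Here [comp_op J q] is the projection of [Y] onto the copy of [Z], and the blocks kept are those
   serving the identity. *)
have [A [w wP]] := @gliding_hump (comp_op J q)
  (fun j => [set w | d (task j) - eps j < `|T (task j) (q w)|])
  (fun j => task j == 0%N) eps eps0 (fun j N => dT (task j) N _ (eps0 j)).
pose S := comp_op q (comp_op (BoundedOp (multiplier_bounded_op basis_e unc_e A)) J).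
(* The aim is that [U i] has essential norm at least [d i]. It nearly agrees with [T i] on the humps
   serving [T i], since [S] almost fixes them for [i = 0] and almost kills them otherwise. *)
pose U i := if i is n.+1 then T n.+1 - S else S.
have US j : `|T (task j) (q (w j)) - U (task j) (q (w j))| <= eps j + eps j.
  have [_ _ _] := wP j; apply: le_trans.
  case: (task j) => [|n] /=.
    rewrite T0 -[X in `|X - _|]qJ -linearB; exact: norm_q.
  rewrite [X in _ - X](_ : _ = T n.+1 (q (w j)) - S (q (w j)))//.
  by rewrite opprB addrC subrK sub0r normrN; exact: norm_q.
(* A late hump serving [T i] makes [C] small. The error [r] splits into a quarter for [C], a quarter
   for nearly attaining [d i], and two for replacing [T i] by [U i]. *)
have U_far i (C : bounded_op Z Z) : compact_op C -> d i <= op_norm (U i - C).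
  move=> /precompactP cC; apply/ler_addgt0Pr => r r0.
  have r40 : 0 < r / 2 / 2 by rewrite !divr_gt0.
  (* The tail estimate concerns operators on [Y], so [C] is carried there as [J C q]. *)
  have cG : compact_op (comp_op J (comp_op C q)).
    apply/precompactP => t /cC[s sP]; exists (map J s) => _ [y y1 <-].
    have [|c cs cx] := sP (C (q y)).
      by exists (q y) => //=; rewrite (le_trans (norm_q _)).
    by exists (J c); [exact: map_f|rewrite /= -linearB norm_J].
  have [N NP] := compact_tail_small basis_e unc_e shrinking_e cG r40.
  have [n nP] := scalar_archimedean r40.
  have [j Nj ji] := task_often i (maxn n N).
  have [w1 tw /= Tw _] := wP j; have {US} := US j; rewrite ji in Tw *.
  set x := q (w j) in Tw * => US.
  have epsj : eps j < r / 2 / 2 by apply: nP; exact: leq_trans (leq_maxl _ _) Nj.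
  have Cx : `|C x| < r / 2 / 2.
    rewrite -norm_J; apply: (NP (w j)) => //.
    by apply: tailS tw; exact: leq_trans (leq_maxr _ _) Nj.
  have Ux : `|(U i - C) x| <= op_norm (U i - C).
    by apply: op_norm_le1; rewrite (le_trans (norm_q _)).
  have Tx : `|T i x| <= `|(U i - C) x| + `|C x| + `|T i x - U i x|.
    have {1}-> : T i x = (U i - C) x + C x + (T i x - U i x).
      by rewrite [X in X + C x](_ : _ = U i x - C x)// subrK addrC subrK.
    by rewrite (le_trans (ler_normD _ _))// lerD2r ler_normD.
  move: Tw; rewrite ltrBlDr => /ltW/le_trans; apply.
  rewrite (le_trans (lerD (le_trans Tx (lerD (lerD Ux (ltW Cx)) US)) (lexx _)))//.
  rewrite -!addrA lerD2l.
  have rE : r / 2 / 2 + (r / 2 / 2 + (r / 2 / 2 + r / 2 / 2)) = r.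
    by rewrite addrA -!splitr.
  by rewrite -[X in _ <= X]rE lerD2l !lerD// ltW.
have S1 : `|quot_proj compacts S| = 1.
  rewrite [LHS]quot_norm_proj; apply/le_anti/andP.
  split; last by apply: dist_carrier_ge => C /(U_far 0%N).
  apply: le_trans (dist_carrier_le _ (carrier0 _)) _; rewrite subr0.
  apply: op_norm_leP => x x1; rewrite (le_trans (norm_q _))//.
  by rewrite (le_trans (multiplier_contraction _ _ _ _))// norm_J.
(* A ball around [S] missing the origin would put the essential norm of [U (f b).+1] strictly below
   that of the centre, which is [d (f b).+1]. *)
have [b Bb] := B_cover _ S1; rewrite -ball_normE /= => bS.
have /andP[_ br] := B_radius _ Bb.
have := lt_le_trans bS br; rewrite -(ball_atK _ Bb) -TE.
have -> : quot_proj compacts (T (f b).+1) - quot_proj compacts S =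
    quot_proj compacts (U (f b).+1).
  by rewrite -scaleN1r -quot_projZ -quot_projD scaleN1r.
rewrite TE [X in X < _]quot_norm_proj => /lt_geF/negbT/negP; apply.
by apply: dist_carrier_ge => C /(U_far (f b).+1).
Qed.

End complemented_copy.

(** Take for [J] the inclusion and for [q] the projection with codomain restricted to [X]. If [X]
    had finite dimension, its Calkin algebra would be zero, with empty unit sphere, and the empty
    family would witness the BCP. *)
Theorem corollary2p2 (R : realType) (k : scalar_kind)
    (Y : completeNormedModType (scalarField R k)) (e : nat -> Y)
    (X : closedSubspace Y) :
  schauder_basis e ->
  one_unconditional e ->
  shrinking e ->
  one_complemented X ->
  ~ finite_dimensional (subspace_type X) ->
  ~ BCP (calkin (subspace_type X)).
Proof.
move=> basis_e [_ unc_e _] shrinking_e [P [PP rangeP normP]].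
have PX y : P y \in carrier_pred X by apply/mem_set; rewrite -rangeP; exists y.
have PK y : carrier X y -> P y = y by rewrite -rangeP => -[z _ <-]; exact: PP.
have Pcontr y : `|P y| <= `|y|.
  by rewrite (le_trans (op_norm_le P y))// -op_normE normP mul1r.
have Jop : (val : subspace_type X -> Y) \in
    @bounded_op_pred R k (subspace_type X) Y.
  apply/asboolP; split; first exact: linearP.
  by exists 1 => x; rewrite mul1r sub_normE.
have qop : (fun y => exist _ (P y) (PX y) : subspace_type X) \in
    @bounded_op_pred R k Y (subspace_type X).
  apply/asboolP; split=> [c x y|].
    by apply: val_inj; rewrite [RHS]linearP; exact: bounded_op_linear.
  exists 1 => y; rewrite mul1r sub_normE.
  exact: Pcontr.
apply: (@calkin_not_BCP R k Y e basis_e unc_e shrinking_e (subspace_type X)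
  (BoundedOp Jop) (BoundedOp qop)) => [z|z|y].
- by apply: val_inj; apply: PK; apply/set_mem; exact: (valP z).
- by [].
- exact: Pcontr.
Qed.
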